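(* Let $m\ge 2$, $n\ge 1$ be integers, $\mathcal{A}=(a_{i_1\ldots i_m})\in T_{m,n}$ and $q\in\mathbb{R}^n$. (i) If $q\ge 0$, then $x=0$ is a (trivial) solution of TCP$(\mathcal{A},q)$. (ii) Let $\mathcal{A}$ be a diagonal tensor. If there exists some $i\in[n]$ such that $q_i<0$ and $a_{i\ldots i}\le 0$, then TCP$(\mathcal{A},q)$ has no solution. Otherwise, TCP$(\mathcal{A},q)$ has a solution $x^*\in\mathbb{R}^n$ whose $i$th component is, for each $i\in[n]$, $$ x^*_i=\begin{cases} 0, & \text{if } q_i\ge 0,\\ \left(\dfrac{-q_i}{a_{i\ldots i}}\right)^{\frac{1}{m-1}}, & \text{if } q_i<0 \text{ and } a_{i\ldots i}>0.\end{cases} $$ (iii) Furthermore, if $\mathcal{A}$ is a diagonal tensor that is positive definite, then TCP$(\mathcal{A},q)$ has a unique solution $x^*\in\mathbb{R}^n$, whose $i$th component is, for each $i\in[n]$, $$ x^*_i=\begin{cases} 0, & \text{if } q_i\ge 0,\\ \left(\dfrac{-q_i}{a_{i\ldots i}}\right)^{\frac{1}{m-1}}, & \text{if } q_i<0.\end{cases} $$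
   Context: $[n]=\{1,\ldots,n\}$. $T_{m,n}$ is the set of all real $m$th-order $n$-dimensional tensors, i.e. arrays $\mathcal{A}=(a_{i_1\ldots i_m})$ of real numbers with $i_1,\ldots,i_m\in[n]$. For $x\in\mathbb{R}^n$, $\mathcal{A}x^{m-1}\in\mathbb{R}^n$ is the vector with components $(\mathcal{A}x^{m-1})_i=\sum_{i_2,\ldots,i_m=1}^{n}a_{ii_2\ldots i_m}x_{i_2}\cdots x_{i_m}$, and $\mathcal{A}x^m=\sum_{i_1,\ldots,i_m=1}^n a_{i_1\ldots i_m}x_{i_1}\cdots x_{i_m}$. Vector inequalities are componentwise. The tensor complementarity problem TCP$(\mathcal{A},q)$ is: find $x\in\mathbb{R}^n$ with $x\ge 0$, $\mathcal{A}x^{m-1}+q\ge 0$ and $x^\top(\mathcal{A}x^{m-1}+q)=0$; such an $x$ is called a solution. $\mathcal{A}$ is diagonal if all its off-diagonal entries are zero, i.e. $a_{i_1\ldots i_m}=0$ unless $i_1=\cdots=i_m$; $a_{i\ldots i}$ denotes the $i$th diagonal entry. $\mathcal{A}$ is positive definite if $\mathcal{A}x^m>0$ for all $x\in\mathbb{R}^n\setminus\{0\}$. *)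

(* Defs.v *)
From mathcomp Require Import all_boot all_order all_algebra.
From mathcomp Require Import reals exp.

Set Implicit Arguments.
Unset Strict Implicit.
Unset Printing Implicit Defensive.

Import Order.TTheory GRing.Theory Num.Theory.
Local Open Scope ring_scope.

Definition tensor (R : realType) (m n : nat) : Type :=
  {ffun m.-tuple 'I_n -> R}.

(* The i-th component sums over all multi-indices (i, i_2, ..., i_m); stating
   "first index is i" by a filter avoids a cast between m and m.-1.+1.  See
   [tensor_applyE] for the form with free indices i_2, ..., i_m. *)
Definition tensor_apply (R : realType) (m n : nat) (A : tensor R m n)
    (x : 'cV[R]_n) : 'cV[R]_n :=
  \col_i \sum_(t : m.-tuple 'I_n | ohead t == Some i)
           A t * \prod_(j <- behead t) x j 0.

Lemma tensor_applyE (R : realType) (k n : nat) (A : tensor R k.+1 n)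
    (x : 'cV[R]_n) (i : 'I_n) :
  tensor_apply A x i 0 =
  \sum_(s : k.-tuple 'I_n) A [tuple of i :: s] * \prod_(j <- s) x j 0.
Proof.
rewrite mxE (reindex_onto (fun s : k.-tuple 'I_n => [tuple of i :: s])
  (fun t : k.+1.-tuple 'I_n => [tuple of behead t])) /=.
  by apply: eq_bigl => s; rewrite eqxx -val_eqE /= eqxx.
by move=> t; case/tupleP: t => a t /= /eqP[->]; apply: val_inj.
Qed.

Definition tensor_form (R : realType) (m n : nat) (A : tensor R m n)
    (x : 'cV[R]_n) : R :=
  \sum_(t : m.-tuple 'I_n) A t * \prod_(j <- t) x j 0.

Definition tensor_diag (R : realType) (m n : nat) (A : tensor R m n)
    (i : 'I_n) : R :=
  A [tuple of nseq m i].

Definition diagonal_tensor (R : realType) (m n : nat) (A : tensor R m n) : Prop :=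
  forall t : m.-tuple 'I_n, ~~ constant t -> A t = 0.

Definition posdef_tensor (R : realType) (m n : nat) (A : tensor R m n) : Prop :=
  forall x : 'cV[R]_n, x != 0 -> 0 < tensor_form A x.

Definition nonneg_vec (R : realType) (n : nat) (x : 'cV[R]_n) : Prop :=
  forall i : 'I_n, 0 <= x i 0.

Definition TCP_solution (R : realType) (m n : nat) (A : tensor R m n)
    (q x : 'cV[R]_n) : Prop :=
  [/\ nonneg_vec x,
      nonneg_vec (tensor_apply A x + q)
    & x^T *m (tensor_apply A x + q) = 0].

(* Main.v *)
Require Import Defs.
From mathcomp Require Import all_boot all_order all_algebra.
From mathcomp Require Import reals exp.

Set Implicit Arguments.
Unset Strict Implicit.
Unset Printing Implicit Defensive.

Import Order.TTheory GRing.Theory Num.Theory.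
Local Open Scope ring_scope.

(** Evaluating a diagonal tensor decouples the coordinates: the [i]-th
    component of [A x^(m-1)] is [a_i x_i^(m-1)], where [a_i] is the [i]-th
    diagonal entry ([diagonal_applyE]).  On nonnegative vectors the
    orthogonality condition of the problem is coordinatewise as well, a
    vanishing sum of nonnegative terms having only zero terms
    ([TCP_solutionP]).  So for diagonal [A] the problem is [n] independent
    scalar complementarity problems [scalar_cp], with [k = m - 1 > 0]:

      [t >= 0],  [a t^k + c >= 0],  [t (a t^k + c) = 0].

    If [c >= 0] then [t = 0] is a solution.  If [c < 0], then [t = 0] violates
    the second condition, hence [t > 0] and [a t^k = - c > 0]; this forces
    [a > 0] and makes [t] the [k]-th root of [- c / a], which is indeed a
    solution when [a > 0].  When [a > 0] the solution [0] is moreover the only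
    one for [c >= 0], because [t > 0] gives [a t^k + c > 0].

    The uniqueness statement reduces to this because the value of the form
    of [A] at the [i]-th basis vector is [a_i] ([posdef_diag_gt0]), so positive
    definiteness makes every [a_i] positive. *)

Lemma prod_nseq (R : pzSemiRingType) (I : Type) (k : nat) (i : I) (f : I -> R) :
  \prod_(j <- nseq k i) f j = f i ^+ k.
Proof. by rewrite big_nseq; elim: k => //= k ->; rewrite exprS. Qed.

(** Order at least two makes every monomial of [A x^(m-1)] contain a factor, so
    that it vanishes at [0]. *)
Lemma tensor_apply0 (R : realType) (k n : nat) (A : tensor R k.+2 n) :
  tensor_apply A 0 = 0.
Proof.
apply/colP => i; rewrite tensor_applyE mxE big1 // => s _.
by case/tupleP: s => j s; rewrite big_cons mxE mul0r mulr0.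
Qed.

(** Among the multi-indices starting with [i], only [(i, ..., i)] is
    constant, hence it carries the only entry that can be nonzero. *)
Lemma diagonal_applyE (R : realType) (k n : nat) (A : tensor R k.+1 n)
    (x : 'cV[R]_n) (i : 'I_n) :
  diagonal_tensor A ->
  tensor_apply A x i 0 = tensor_diag A i * x i 0 ^+ k.
Proof.
move=> dA; rewrite tensor_applyE (bigD1 [tuple of nseq k i]) //= prod_nseq.
rewrite [X in _ + X]big1 ?addr0 => [|s s_neq].
  by congr (A _ * _); apply: val_inj.
rewrite dA ?mul0r //=; apply: contra s_neq => /all_pred1P s_nseq.
by apply/eqP/val_inj; rewrite /= {1}s_nseq size_tuple.
Qed.

(** At the basis vector [e_i] only the multi-index [(i, ..., i)] contributes
    to the form. *)
Lemma posdef_diag_gt0 (R : realType) (m n : nat) (A : tensor R m n)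
    (i : 'I_n) :
  posdef_tensor A -> 0 < tensor_diag A i.
Proof.
pose e : 'cV[R]_n := delta_mx i 0.
have e_neq0 : e != 0.
  by apply/eqP => /colP/(_ i)/eqP; rewrite !mxE !eqxx oner_eq0.
move=> /(_ e e_neq0); rewrite /tensor_form (bigD1 [tuple of nseq m i]) //=.
rewrite prod_nseq mxE !eqxx expr1n mulr1 big1 ?addr0 // => t t_neq.
have /allPn[j jt j_neq] : ~~ all (pred1 i) t.
  apply: contra t_neq => /all_pred1P t_nseq.
  by apply/eqP/val_inj; rewrite /= {1}t_nseq size_tuple.
by rewrite (big_rem j jt) mxE [j == i](negbTE j_neq) /= mul0r mulr0.
Qed.

Definition scalar_cp (R : realType) (k : nat) (a c t : R) : Prop :=
  [/\ 0 <= t, 0 <= a * t ^+ k + c & t * (a * t ^+ k + c) = 0].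

Definition scalar_sol (R : realType) (k : nat) (a c : R) : R :=
  if 0 <= c then 0 else (- c / a) `^ (1 / k%:R).

Lemma powR_rootK (R : realType) (k : nat) (b : R) :
  0 <= b -> (b `^ (1 / k.+1%:R)) ^+ k.+1 = b.
Proof.
move=> b0; rewrite -powR_mulrn ?powR_ge0 // -powRrM mul1r.
by rewrite mulVf ?powRr1 ?pnatr_eq0.
Qed.

(** For [c < 0] the complementarity problem is an equation: [t = 0] would leave
    [0 <= c], so the other factor of the product has to vanish. *)
Lemma scalar_cp_neg_eq (R : realType) (k : nat) (a c t : R) :
  c < 0 -> scalar_cp k.+1 a c t -> 0 < t /\ a * t ^+ k.+1 = - c.
Proof.
move=> c0 [t0 ge0 /eqP]; rewrite mulf_eq0; case: eqVneq => [t_eq0|t_neq0] /=.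
  by move: ge0; rewrite t_eq0 expr0n mulr0 add0r leNgt c0.
by rewrite addr_eq0 => /eqP; split; rewrite // lt0r t_neq0.
Qed.

Lemma scalar_cp_neg_lead (R : realType) (k : nat) (a c t : R) :
  c < 0 -> scalar_cp k.+1 a c t -> 0 < a.
Proof.
move=> c0 /(scalar_cp_neg_eq c0)[t0 at_eq].
by rewrite -(pmulr_lgt0 _ (exprn_gt0 k.+1 t0)) at_eq oppr_gt0.
Qed.

Lemma scalar_solP (R : realType) (k : nat) (a c : R) :
  (c < 0 -> 0 < a) -> scalar_cp k.+1 a c (scalar_sol k.+1 a c).
Proof.
rewrite /scalar_cp /scalar_sol; case: leP => [c0 _|c0 /(_ isT) a0].
  by rewrite expr0n mulr0 add0r mul0r.
have b0 : 0 <= - c / a by rewrite divr_ge0 ?oppr_ge0 ?ltW.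
by rewrite powR_rootK // [a * _]mulrC divfK ?gt_eqF // addNr mulr0 powR_ge0.
Qed.

(** Taking positive powers is injective on nonnegative reals, so for [c < 0]
    the equation [a t^(k+1) = - c] determines [t]. *)
Lemma scalar_cp_unique (R : realType) (k : nat) (a c t : R) :
  0 < a -> scalar_cp k.+1 a c t -> t = scalar_sol k.+1 a c.
Proof.
move=> a0 cp; rewrite /scalar_sol; case: leP => [c0|c0].
  case: cp => t0 _ /eqP; rewrite mulf_eq0 => /orP[/eqP //|].
  rewrite paddr_eq0 ?mulr_ge0 ?exprn_ge0 ?(ltW a0) // mulf_eq0 gt_eqF //=.
  by rewrite expf_eq0 /= => /andP[/eqP].
have [t0 at_eq] := scalar_cp_neg_eq c0 cp.
apply: (pexpIrn (ltn0Sn k)); rewrite ?nnegrE ?powR_ge0 ?(ltW t0) //.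
rewrite powR_rootK; last by rewrite divr_ge0 ?oppr_ge0 ?ltW.
by rewrite -at_eq mulrAC divff ?mul1r ?gt_eqF.
Qed.

(** The inner product of two nonnegative vectors is a sum of nonnegative terms,
    so it vanishes only if each of its terms does. *)
Lemma TCP_solutionP (R : realType) (m n : nat) (A : tensor R m n)
    (q x : 'cV[R]_n) :
  TCP_solution A q x <->
  forall i, let y := tensor_apply A x i 0 + q i 0 in
    [/\ 0 <= x i 0, 0 <= y & x i 0 * y = 0].
Proof.
have dotE : (x^T *m (tensor_apply A x + q)) 0 0 =
    \sum_i x i 0 * (tensor_apply A x i 0 + q i 0).
  by rewrite !mxE; apply: eq_bigr => i _; rewrite !mxE.
split=> [[x0 y0 xy0] i /= | sol].
  have {}y0 j : 0 <= tensor_apply A x j 0 + q j 0 by have := y0 j; rewrite mxE.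
  split=> //; apply: (psumr_eq0P (P := xpredT)
    (F := fun j => x j 0 * (tensor_apply A x j 0 + q j 0))) => // [j _|].
    by rewrite mulr_ge0.
  by rewrite -dotE xy0 mxE.
split=> [i|i|]; first by case: (sol i).
  by rewrite mxE; case: (sol i).
apply/matrixP => i j; rewrite !ord1 dotE mxE big1 // => l _.
by case: (sol l).
Qed.

Lemma diagonal_TCP_solutionP (R : realType) (k n : nat) (A : tensor R k.+1 n)
    (q x : 'cV[R]_n) :
  diagonal_tensor A ->
  TCP_solution A q x <->
  forall i, scalar_cp k (tensor_diag A i) (q i 0) (x i 0).
Proof.
move=> dA; split=> [/TCP_solutionP sol i | sol].
  by have := sol i; rewrite /= diagonal_applyE.
by apply/TCP_solutionP => i; rewrite /= diagonal_applyE //; exact: sol.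
Qed.

Theorem theorem1 (R : realType) (m n : nat) (hm : (2 <= m)%N) (hn : (1 <= n)%N)
    (A : tensor R m n) (q : 'cV[R]_n) :
  (nonneg_vec q -> TCP_solution A q 0)
  /\
  (diagonal_tensor A ->
     ((exists i : 'I_n, q i 0 < 0 /\ tensor_diag A i <= 0) ->
        ~ exists x : 'cV[R]_n, TCP_solution A q x)
     /\
     (~ (exists i : 'I_n, q i 0 < 0 /\ tensor_diag A i <= 0) ->
        exists xs : 'cV[R]_n,
          TCP_solution A q xs /\
          forall i : 'I_n,
            (0 <= q i 0 -> xs i 0 = 0) /\
            (q i 0 < 0 -> 0 < tensor_diag A i ->
               xs i 0 = (- q i 0 / tensor_diag A i) `^ (1 / (m - 1)%:R))))
  /\
  (diagonal_tensor A -> posdef_tensor A ->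
     exists xs : 'cV[R]_n,
       unique (TCP_solution A q) xs /\
       forall i : 'I_n,
         (0 <= q i 0 -> xs i 0 = 0) /\
         (q i 0 < 0 ->
            xs i 0 = (- q i 0 / tensor_diag A i) `^ (1 / (m - 1)%:R))).
Proof.
case: m hm A => [|[|k]] // _ A; rewrite subn1 /=.
pose xs : 'cV[R]_n := \col_i scalar_sol k.+1 (tensor_diag A i) (q i 0).
have xs_ge0 i : 0 <= q i 0 -> xs i 0 = 0.
  by move=> q0; rewrite mxE /scalar_sol q0.
have xs_lt0 i : q i 0 < 0 ->
    xs i 0 = (- q i 0 / tensor_diag A i) `^ (1 / k.+1%:R).
  by move=> q0; rewrite mxE /scalar_sol leNgt q0.
have xs_sol : diagonal_tensor A ->
    (forall i, q i 0 < 0 -> 0 < tensor_diag A i) -> TCP_solution A q xs.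
  move=> dA a0; apply/diagonal_TCP_solutionP => // i.
  by rewrite mxE; apply/scalar_solP/a0.
split=> [q0|].
  by apply/TCP_solutionP => i /=; rewrite tensor_apply0 !mxE add0r mul0r.
split=> [dA|dA pA].
  split=> [[i [q0 a0]] [x /(diagonal_TCP_solutionP _ _ dA)/(_ i)] | no_bad].
    by move/(scalar_cp_neg_lead q0); rewrite ltNge a0.
  exists xs; split; last by move=> i; split=> [/xs_ge0|/xs_lt0].
  apply: xs_sol => // i q0; rewrite ltNge; apply/negP => a0.
  by apply: no_bad; exists i.
have a0 i : 0 < tensor_diag A i := posdef_diag_gt0 i pA.
exists xs; split; last by move=> i; split=> [/xs_ge0|/xs_lt0].
split=> [|x /(diagonal_TCP_solutionP _ _ dA) sol]; first exact: xs_sol.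
by apply/colP => i; rewrite mxE; apply/esym/scalar_cp_unique.
Qed.
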